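(* Consider a plane elliptic cubic in $(\mathbb{C}\{\!\{t\}\!\}^* )^2$ defined by $g\in \mathbb{C}\{\!\{t\}\!\}[x_1,x_2]$. Assume that $\operatorname{val}(j(g))<0$ and that $\operatorname{Trop}(g)$ contains a cycle whose length does not reflect the $j$-invariant, i.e. whose length is not equal to $-\operatorname{val}(j(g))$. Then the cycle can be recursively repaired with linear tropical modifications of the ambient space, and the resulting ambient space has dimension at most $4$. That is, there is a linear re-embedding of the curve in dimension $r\le 4$, obtained recursively by linear tropical modifications, whose tropicalization in $\mathbb{R}^r$ contains a cycle of length $-\operatorname{val}(j(g))$.
   Context: $\mathbb{C}\{\!\{t\}\!\}$ is the field of Puiseux series with $\operatorname{val}$ the leading exponent. Tropicalizations are taken with the max-convention (coordinatewise $-\operatorname{val}$) of the part of the variety lying in the algebraic torus. A plane elliptic cubic is a smooth genus one curve given by a polynomial $g$ of degree $3$; $j(g)$ denotes its $j$-invariant. The length of a cycle in a tropical curve is its lattice length (sum of the lattice lengths of its edges). Linear tropical modifications and re-embeddings. For a linear tropical polynomial $F=\max\{A,B+X,C+Y\}$ with $A,B,C\in\mathbb{R}\cup\{-\infty\}$, the tropical modification of $\mathbb{R}^2$ along $F$ is the tropical surface in $\mathbb{R}^3$ obtained from the graph of $F$ by attaching at each break line a two-dimensional cell in direction $(0,0,-1)$. A lifting of $F$ is $f=a+bx+cy$ with $-\operatorname{val}(a)=A$, $-\operatorname{val}(b)=B$, $-\operatorname{val}(c)=C$, and the associated linear re-embedding of the curve replaces $\langle g\rangle$ by $\langle g, z-f\rangle$,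 i.e. it adjoins the new coordinate $z=f$. Recursive repair means: repeatedly adjoin new coordinates $z=f$, where $f$ is a lifting of a linear tropical polynomial in two of the coordinates available so far, and possibly drop (project away) coordinates. The result is an embedding of the curve by affine-linear functions $\ell_1,\dots,\ell_r\in\mathbb{C}\{\!\{t\}\!\}[x_1,x_2]$ whose restrictions are coordinates of a plane in $r$-dimensional affine space (so that the curve is still embedded); its tropicalization is the tropicalization of the image of the curve in $\mathbb{R}^r$, and $r$ is the dimension of the ambient space. *)

(* Defs.v *)
From HB Require Import structures.
From mathcomp Require Import all_boot all_order all_algebra.
From mathcomp Require Import boolp classical_sets functions fsbigop.
From mathcomp Require Import reals ereal topology normedtype.
From mathcomp Require Import complex.
From mathcomp Require Import lra ring zify.
(* The notations of mpoly clash with those of MathComp-Analysis. *)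
From mathcomp Require Import -(notations) mpoly.
Set Implicit Arguments.
Unset Strict Implicit.
Unset Printing Implicit Defensive.
Import Order.TTheory GRing.Theory Num.Theory.
Import numFieldNormedType.Exports.
Local Open Scope classical_set_scope.
Local Open Scope ring_scope.

(* Puiseux series over [F]: a series sum_q (f q) t^q is encoded by its
   coefficient function [f : rat -> F], whose support lies in
   {(m + k) / (n + 1) | k : nat} for some [n : nat] and [m : int].  *)
Section PuiseuxSeries.
Variable F : fieldType.
Implicit Types (a b c : nat -> F) (m : int).

Definition expo (n : nat) (m : int) (k : nat) : rat :=
  (m%:~R + k%:R) / n.+1%:R.

Definition exps_in (n : nat) (m : int) (f : rat -> F) : Prop :=
  forall q, f q != 0 -> exists k, q = expo n m k.

Definition is_puiseux (f : rat -> F) : bool :=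
  `[< exists n m, exps_in n m f >].

Lemma expo_inj n m : injective (expo n m).
Proof.
move=> k l /(congr1 (fun q => q * n.+1%:R)); rewrite /expo !divfK ?pnatr_eq0//.
by move/addrI/eqP; rewrite eqr_nat => /eqP.
Qed.

Lemma expoD n m1 m2 k l : expo n m1 k + expo n m2 l = expo n (m1 + m2) (k + l).
Proof. by rewrite /expo -mulrDl intrD natrD addrACA. Qed.

Lemma expoB n m1 m2 k l : (l <= k)%N ->
  expo n (m1 + m2) k - expo n m1 l = expo n m2 (k - l).
Proof.
by move=> lk; apply/eqP; rewrite subr_eq expoD [m2 + _]addrC subnK.
Qed.

Lemma exps_in_widen n m n' m' d f : n'.+1 = (d * n.+1)%N -> m' <= m * d%:Z ->
  exps_in n m f -> exps_in n' m' f.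
Proof.
move=> nE mm' Hf q /Hf[k ->].
exists (k * d + absz (m * d%:Z - m')%R)%N.
have d0 : d%:R != 0 :> rat by rewrite pnatr_eq0; case: d nE {mm'}; lia.
have H1 : (absz (m * d%:Z - m')%R)%:R = m%:~R * d%:R - m'%:~R :> rat.
  by rewrite pmulrn gez0_abs ?subr_ge0// intrB intrM.
rewrite /expo nE natrD natrM natrM H1.
have n0 : n.+1%:R != 0 :> rat by rewrite pnatr_eq0.
by field; rewrite addrC natr1 n0 d0.
Qed.

Lemma exps_in_common (s : seq (rat -> F)) : all is_puiseux s ->
  exists n m, forall f, f \in s -> exps_in n m f.
Proof.
elim: s => [_|f s IH /= /andP[/asboolP[n1 [m1 Hf]] /IH[n2 [m2 Hs]]]].
  by exists 0%N, 0.
exists (n1.+1 * n2.+1).-1%N, (Num.min (m1 * n2.+1%:Z) (m2 * n1.+1%:Z)) => g.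
rewrite in_cons => /predU1P[->|/Hs gs].
- by apply: (@exps_in_widen _ _ _ _ n2.+1) Hf; [lia|rewrite ge_min lexx].
- by apply: (@exps_in_widen _ _ _ _ n1.+1) gs; [lia|rewrite ge_min lexx orbT].
Qed.

(* sum_k (a k) t^((m + k) / (n + 1)) *)
Definition pser n m a : rat -> F := fun q =>
  \sum_(k \in [set k | q = expo n m k]) a k.

Lemma pserE n m a k : pser n m a (expo n m k) = a k.
Proof.
rewrite /pser (_ : [set _ | _] = [set k]) ?fsbig_set1//.
by apply/seteqP; split=> [l /expo_inj ->|l ->].
Qed.

Lemma pser_exps n m a : exps_in n m (pser n m a).
Proof.
move=> q; apply: contra_neqP => /forallNP nq; rewrite /pser fsbig1// => k /=.
by move/nq.
Qed.

Lemma exps_in_eq n m f g : exps_in n m f -> exps_in n m g ->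
  (forall k, f (expo n m k) = g (expo n m k)) -> f = g.
Proof.
move=> Hf Hg fg; apply/funext => q.
have [f0|/Hf[k ->]//] := eqVneq (f q) 0.
by have [g0|/Hg[k ->]//] := eqVneq (g q) 0; rewrite f0.
Qed.

Lemma pser_def n m f : exps_in n m f -> f = pser n m (fun k => f (expo n m k)).
Proof.
move=> Hf; apply: (exps_in_eq Hf (@pser_exps _ _ _)) => k; by rewrite pserE.
Qed.

Lemma pser_puiseux n m a : is_puiseux (pser n m a).
Proof. by apply/asboolP; exists n, m; exact: pser_exps. Qed.

Lemma puiseux0 : is_puiseux 0.
Proof. by apply/asboolP; exists 0%N, 0 => q; rewrite eqxx. Qed.

Lemma puiseuxB : {in is_puiseux &, forall f g, is_puiseux (f - g)}.
Proof.
move=> f g Pf Pg; have /exps_in_common[n [m H]] : all is_puiseux [:: f; g].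
  by rewrite /= [is_puiseux f]Pf [is_puiseux g]Pg.
have [Hf Hg] : exps_in n m f /\ exps_in n m g.
  by split; apply: H; rewrite !inE eqxx ?orbT.
apply/asboolP; exists n, m => q.
have [f0|/Hf//] := eqVneq (f q) 0.
have [g0|/Hg//] := eqVneq (g q) 0.
by rewrite /GRing.add /GRing.opp /= f0 g0 subr0 eqxx.
Qed.

Definition conv a b : nat -> F := fun k => \sum_(i < k.+1) a i * b (k - i)%N.

Lemma convE K a b k : (k < K)%N ->
  conv a b k = (\poly_(i < K) a i * \poly_(i < K) b i)`_k.
Proof.
move=> kK; rewrite coefM; apply: eq_bigr => i _.
by rewrite !coef_poly (leq_ltn_trans (leq_ord i) kK)
  (leq_ltn_trans (leq_subr _ _) kK).
Qed.

Lemma convC a b : conv a b = conv b a.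
Proof. by apply/funext => k; rewrite !(@convE k.+1)// mulrC. Qed.

Lemma convDl a b c : conv (a + b) c = conv a c + conv b c.
Proof.
apply/funext => k; change (conv (a + b) c k = conv a c k + conv b c k).
rewrite /conv -big_split/=; by apply: eq_bigr => i _; rewrite -mulrDl.
Qed.

Lemma convA a b c : conv a (conv b c) = conv (conv a b) c.
Proof.
have E a' b' c' k : conv (conv a' b') c' k = (\poly_(i < k.+1) a' i *
    \poly_(i < k.+1) b' i * \poly_(i < k.+1) c' i)`_k.
  rewrite coefM; apply: eq_bigr => i _.
  by rewrite (@convE k.+1)// coef_poly ltnS leq_subr.
apply/funext => k; rewrite convC !E; congr (_`_k).
by rewrite mulrC mulrA.
Qed.

Definition mul_fun (f g : rat -> F) : rat -> F :=
  fun q => \sum_(p \in [set: rat]) f p * g (q - p).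

Lemma mul_pser n m1 m2 a b :
  mul_fun (pser n m1 a) (pser n m2 b) = pser n (m1 + m2) (conv a b).
Proof.
have supp q p : pser n m1 a p * pser n m2 b (q - p) != 0 ->
    exists k l, p = expo n m1 k /\ q = expo n (m1 + m2) (k + l).
  rewrite mulf_eq0 negb_or => /andP[/pser_exps[k ->] /pser_exps[l H]].
  by exists k, l; split => //; rewrite -expoD -H addrC subrK.
apply: (@exps_in_eq n (m1 + m2)); last 2 first.
- exact: pser_exps.
- move=> k; rewrite pserE /conv.
  pose s := [seq expo n m1 i | i <- iota 0 k.+1].
  have us : uniq s by rewrite map_inj_uniq ?iota_uniq//; exact: expo_inj.
  rewrite /mul_fun -(@fsbig_widen _ _ _ _ [set` s])//; last first.
    move=> p [_ /= ps]; apply: contra_notP ps => /eqP/supp[i [j [-> kE]]].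
    by apply/map_f; rewrite mem_iota/= add0n ltnS (expo_inj kE) leq_addr.
  rewrite -fsbig_seq// big_map -(big_mkord xpredT (fun i => a i * b (k - i)%N)).
  rewrite /index_iota subn0 !big_seq; apply: eq_bigr => i.
  by rewrite mem_iota/= add0n ltnS => ik; rewrite pserE expoB// pserE.
move=> q; apply: contra_neqP => /forallNP nq; rewrite /mul_fun fsbig1// => p _.
by apply/eqP/negPn/negP => /supp[k [l [_ /nq]]].
Qed.

Record puiseux := Puiseux { pcoef :> rat -> F ; _ : is_puiseux pcoef }.
HB.instance Definition _ := [isSub for pcoef].
HB.instance Definition _ := [Choice of puiseux by <:].
Fact puiseux_zmod_closed : zmod_closed is_puiseux.
Proof. split; [exact: puiseux0 | exact: puiseuxB]. Qed.
HB.instance Definition _ :=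
  GRing.isZmodClosed.Build (rat -> F) is_puiseux puiseux_zmod_closed.
HB.instance Definition _ := [SubChoice_isSubZmodule of puiseux by <:].


Lemma puiseuxP (f g : puiseux) : pcoef f = pcoef g -> f = g.
Proof. exact: val_inj. Qed.

Lemma common1 (f : puiseux) : exists n m a, pcoef f = pser n m a.
Proof.
have [n [m H]] : exists n m, exps_in n m f by apply/asboolP/(valP f).
by exists n, m, (fun k => f (expo n m k)); exact: pser_def.
Qed.

Lemma common3 (f g h : puiseux) : exists n m a b c,
  [/\ pcoef f = pser n m a, pcoef g = pser n m b & pcoef h = pser n m c].
Proof.
have [n [m H]] : exists n m, forall u, u \in [:: pcoef f; pcoef g; pcoef h] ->
    exps_in n m u.
  apply: exps_in_common; rewrite /= andbT; apply/and3P.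
  by split; exact: valP.
exists n, m, (fun k => f (expo n m k)), (fun k => g (expo n m k)),
  (fun k => h (expo n m k)).
by split; apply/pser_def/H; rewrite !inE eqxx ?orbT.
Qed.

Lemma mul_puiseux (f g : puiseux) : is_puiseux (mul_fun f g).
Proof.
have [n [m [a [b [_ [-> -> _]]]]]] := common3 f g f.
by rewrite mul_pser; exact: pser_puiseux.
Qed.

Definition puiseux_mul (f g : puiseux) : puiseux := Puiseux (mul_puiseux f g).

Definition delta0 : nat -> F := fun k => (k == 0%N)%:R.

Lemma conv1l a : conv delta0 a = a.
Proof.
apply/funext => k; rewrite /conv big_ord_recl /= subn0 mul1r.
by rewrite big1 ?addr0// => i _; rewrite mul0r.
Qed.

Definition one_fun : rat -> F := fun q => (q == 0)%:R.

Lemma one_pser n : one_fun = pser n 0 delta0.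
Proof.
apply: (@exps_in_eq n 0).
- move=> q; rewrite /one_fun; have [->|_] := eqVneq q 0; last by rewrite eqxx.
  by exists 0%N; rewrite /expo addr0 mul0r.
- exact: pser_exps.
- move=> k; rewrite pserE /one_fun /expo add0r mulf_eq0 invr_eq0 !pnatr_eq0.
  by rewrite orbF.
Qed.

Lemma one_puiseux : is_puiseux one_fun.
Proof. by rewrite (one_pser 0); exact: pser_puiseux. Qed.

Definition puiseux_one : puiseux := Puiseux one_puiseux.

Lemma puiseux_mulA : associative puiseux_mul.
Proof.
move=> f g h; apply: puiseuxP => /=.
have [n [m [a [b [c [-> -> ->]]]]]] := common3 f g h.
by rewrite !mul_pser convA addrA.
Qed.

Lemma puiseux_mulC : commutative puiseux_mul.
Proof.
move=> f g; apply: puiseuxP => /=.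
have [n [m [a [b [_ [-> -> _]]]]]] := common3 f g f.
by rewrite !mul_pser convC.
Qed.

Lemma puiseux_mul1 : left_id puiseux_one puiseux_mul.
Proof.
move=> f; apply: puiseuxP => /=; have [n [m [a ->]]] := common1 f.
by rewrite (one_pser n) mul_pser conv1l add0r.
Qed.

Lemma pserD n m a b : pser n m a + pser n m b = pser n m (a + b).
Proof.
apply: (@exps_in_eq n m).
- move=> q H; have [a0|/pser_exps//] := eqVneq (pser n m a q) 0.
  have [b0|/pser_exps//] := eqVneq (pser n m b q) 0.
  by move: H; rewrite [X in X != 0](_ : _ = pser n m a q + pser n m b q)// a0 b0
    addr0 eqxx.
- exact: pser_exps.
- move=> k; rewrite pserE.
  by change (pser n m a (expo n m k) + pser n m b (expo n m k) = a k + b k);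
    rewrite !pserE.
Qed.

Lemma puiseux_mulDl : left_distributive puiseux_mul +%R.
Proof.
move=> f g h; apply: puiseuxP => /=.
have [n [m [a [b [c [-> -> ->]]]]]] := common3 f g h.
by rewrite pserD !mul_pser convDl pserD.
Qed.

Lemma puiseux_1neq0 : puiseux_one != 0.
Proof.
apply/eqP => /(congr1 (fun f : puiseux => pcoef f 0))/eqP.
by rewrite /= /one_fun eqxx oner_eq0.
Qed.

HB.instance Definition _ := GRing.Zmodule_isComNzRing.Build puiseux
  puiseux_mulA puiseux_mulC puiseux_mul1 puiseux_mulDl puiseux_1neq0.

Fixpoint inv_coefs a (k : nat) : seq F :=
  if k is l.+1 then
    let s := inv_coefs a l in
    rcons s ((a 0%N)^-1 *
             ((l == 0%N)%:R - \sum_(i < l) s`_i * a (l - i)%N))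
  else [::].

Lemma size_inv_coefs a k : size (inv_coefs a k) = k.
Proof. by elim: k => //= k IH; rewrite size_rcons IH. Qed.

Lemma inv_coefs_nth a k i : (i < k)%N ->
  (inv_coefs a k)`_i = (inv_coefs a i.+1)`_i.
Proof.
elim: k => // k IH; rewrite ltnS leq_eqVlt => /predU1P[->//|ik].
by rewrite [LHS]/= nth_rcons size_inv_coefs ik IH.
Qed.

Lemma conv_inv a : a 0%N != 0 ->
  conv (fun k => (inv_coefs a k.+1)`_k) a = delta0.
Proof.
move=> a0; apply/funext => k; rewrite /conv big_ord_recr/= subnn.
rewrite nth_rcons size_inv_coefs ltnn eqxx mulrC mulVKf//.
rewrite (eq_bigr (fun i : 'I_k => (inv_coefs a k)`_i * a (k - i)%N)).
  by rewrite addrC subrK.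
by move=> i _; rewrite (inv_coefs_nth _ (ltn_ord i)).
Qed.

Lemma lead_pser (f : puiseux) : f != 0 ->
  exists n m a, a 0%N != 0 /\ pcoef f = pser n m a.
Proof.
move=> f0; have [n [m [a fE]]] := common1 f.
have exa : exists k, a k != 0.
  apply: contrapT => /forallNP Ha; move/eqP: f0; apply; apply: puiseuxP.
  rewrite fE; apply: (exps_in_eq (@pser_exps _ _ _)) => [q|k].
    by rewrite eqxx.
  by rewrite pserE; apply/eqP/negPn/negP/Ha.
case: (ex_minnP exa) => k ak kmin.
exists n, (m + k%:Z), (fun l => a (k + l)%N); split; first by rewrite addn0.
have expE l : expo n (m + k%:Z) l = expo n m (k + l).
  by rewrite /expo intrD natrD addrA.
rewrite fE; apply: (@exps_in_eq n (m + k%:Z)).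
- move=> q Hq; have [l qE] := pser_exps Hq; move: Hq; rewrite qE pserE => al.
  by exists (l - k)%N; rewrite expE subnKC// kmin.
- exact: pser_exps.
- by move=> l; rewrite pserE expE pserE.
Qed.

Lemma puiseux_inv_ex (f : puiseux) : f != 0 -> exists g : puiseux, g * f = 1.
Proof.
move=> /lead_pser[n [m [a [a0 fE]]]].
exists (Puiseux (pser_puiseux n (- m) (fun k => (inv_coefs a k.+1)`_k))).
apply: puiseuxP; rewrite /= fE mul_pser conv_inv//.
by rewrite addNr -one_pser.
Qed.

Definition puiseux_inv (f : puiseux) : puiseux :=
  xget 0 [set g : puiseux | g * f = 1].

Lemma puiseux_mulVf (f : puiseux) : f != 0 -> puiseux_inv f * f = 1.
Proof. by move=> /puiseux_inv_ex[g gf]; rewrite /puiseux_inv; case: xgetP => [//|/(_ g)]. Qed.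

Lemma puiseux_inv0 : puiseux_inv 0 = 0.
Proof.
rewrite /puiseux_inv; case: xgetP => // g _ /=; rewrite mulr0 => /esym/eqP.
by rewrite oner_eq0.
Qed.

HB.instance Definition _ :=
  GRing.ComNzRing_isField.Build puiseux puiseux_mulVf puiseux_inv0.

End PuiseuxSeries.

Section Valuation.
Variables (R : realType) (F : fieldType).

Definition pval (f : puiseux F) : \bar R :=
  ereal_inf [set (ratr q : R)%:E | q in [set q | f q != 0]].

Lemma pval0 : pval 0 = +oo%E.
Proof.
rewrite /pval (_ : [set _ | _ in _] = set0) ?ereal_inf0//.
by apply/seteqP; split => // y [q] /eqP.
Qed.

Lemma pvalP (f : puiseux F) : f != 0 -> exists q,
  [/\ f q != 0, forall p, p < q -> f p = 0 & pval f = (ratr q : R)%:E].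
Proof.
move=> /lead_pser[n [m [a [a0 fE]]]]; exists (expo n m 0).
have f0 : f (expo n m 0) != 0 by rewrite fE pserE.
have fmin p : f p != 0 -> expo n m 0 <= p.
  rewrite fE => /pser_exps[k ->].
  by rewrite /expo ler_pM2r ?invr_gt0 ?ltr0n// lerD2l ler_nat.
split => //.
  by move=> p pq; apply/eqP/negPn/negP => /fmin; rewrite leNgt pq.
apply/eqP; rewrite eq_le; apply/andP; split.
  by apply: ereal_inf_lbound; exists (expo n m 0).
by apply: le_ereal_inf_tmp => _ [p /= /fmin fp <-]; rewrite lee_fin ler_rat.
Qed.

End Valuation.

Notation puiseuxC R := (puiseux (complex (Real.sort R))).

Section PlaneCubics.
Variable K : fieldType.

Definition Xvar (n : nat) (i : 'I_n) : mpoly n K := mpolyX K (mnm1 i).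

(* The homogenizing variable has index 0, and the variable [i] of [g] becomes
   the variable [i + 1]. *)
Definition homogenize (d : nat) (g : mpoly 2 K) : mpoly 3 K :=
  \sum_(m <- msupp g) mcoeff m g *:
    (Xvar ord0 ^+ (d - mdeg m) * \prod_(i < 2) Xvar (lift ord0 i) ^+ m i).

Definition smooth_projective (G : mpoly 3 K) : Prop :=
  forall x : 'rV[K]_3, x != 0 -> meval (x ord0) G = 0 ->
    exists i, meval (x ord0) (mderiv i G) != 0.

(* [msize] is one more than the total degree.  The genus one condition is
   smoothness of the projective closure. *)
Definition plane_elliptic_cubic (g : mpoly 2 K) : Prop :=
  msize g = 4 /\ smooth_projective (homogenize 3 g).

Definition weierstrass (a b : K) : mpoly 2 K :=
  let x := Xvar ord0 in let y := Xvar ord_max in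
  y ^+ 2 - (x ^+ 3 + a *: x + mpolyC 2 b).

(* Over an algebraically closed field of characteristic 0 every smooth plane
   cubic is projectively equivalent to one in short Weierstrass form, and [j]
   does not depend on the choice of the Weierstrass form. *)
Definition is_j_invariant (g : mpoly 2 K) (j : K) : Prop :=
  exists (M : 'M[K]_3) (u a b : K),
    [/\ M \in unitmx, u != 0, 4 * a ^+ 3 + 27 * b ^+ 2 != 0,
        comp_mpoly [tuple \sum_(k < 3) M i k *: Xvar k | i < 3] (homogenize 3 g)
          = u *: homogenize 3 (weierstrass a b) &
        j = 1728 * (4 * a ^+ 3) / (4 * a ^+ 3 + 27 * b ^+ 2)].

End PlaneCubics.

Section TropicalCycles.
Variables (R : realType) (n : nat).
Implicit Types (p q : 'rV[R]_n) (T : set 'rV[R]_n).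

Definition segment p q : set 'rV[R]_n :=
  [set (1 - t) *: p + t *: q | t in [set t : R | 0 <= t <= 1]].

Definition primitive (u : 'rV[int]_n) : Prop :=
  \big[gcdn/0%N]_(i < n) absz (u ord0 i) = 1%N.

Definition lattice_length p q (l : R) : Prop :=
  0 < l /\ exists2 u, primitive u & q - p = l *: map_mx intr u.

(* A cycle is a simple closed polygon with edges [p i, p (i + 1)], where [i]
   ranges over Z/k. *)
Definition contains_cycle T (len : R) : Prop :=
  exists (k : nat) (p : 'I_k -> 'rV[R]_n) (l : 'I_k -> R),
    [/\ (3 <= k)%N,
        forall i, segment (p i) (p (ordS i)) `<=` T,
        forall i j x, i != j ->
          segment (p i) (p (ordS i)) x -> segment (p j) (p (ordS j)) x ->
          (j = ordS i /\ x = p j) \/ (i = ordS j /\ x = p i),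
        forall i, lattice_length (p i) (p (ordS i)) (l i) &
        len = \sum_(i < k) l i].

End TropicalCycles.

Section LinearReembeddings.
Variable R : realType.
Local Notation K := (puiseuxC R).

(* The tropicalization of the image of the affine curve [g = 0] in R^r, for
   the coordinates given by the sequence [s] of [r] polynomials.  Valuations
   are rational, hence the closure. *)
Definition trop_curve (g : mpoly 2 K) (s : seq (mpoly 2 K)) :
    set 'rV[R]_(size s) :=
  closure [set \row_i (- fine (pval R (meval (x ord0) s`_i))) |
           x in [set x : 'rV[K]_2 | meval (x ord0) g = 0 /\
                   forall i : 'I_(size s), meval (x ord0) s`_i != 0]].

Definition plane_coords : seq (mpoly 2 K) := [:: Xvar K ord0; Xvar K ord_max].

(* The tropical polynomial max {A, B + X, C + Y}; -oo stands for an absent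
   term. *)
Record trop_linear := TropLinear {
  tconst : \bar R; tcoefX : \bar R; tcoefY : \bar R;
  trop_linear_fin : [/\ tconst != +oo%E, tcoefX != +oo%E & tcoefY != +oo%E] }.

Definition is_lifting (P : trop_linear) (a b c : K) : Prop :=
  [/\ (- pval R a = tconst P)%E, (- pval R b = tcoefX P)%E &
      (- pval R c = tcoefY P)%E].

(* Embeddings are recorded as sequences of coordinate functions, written as
   affine-linear polynomials in the original coordinates of the plane. *)
Inductive linear_repair : seq (mpoly 2 K) -> Prop :=
| repair_start : linear_repair plane_coords
| repair_modify (s : seq (mpoly 2 K)) (i j : nat) (P : trop_linear) (a b c : K) :
    linear_repair s -> (i < size s)%N -> (j < size s)%N -> i != j ->
    is_lifting P a b c ->
    linear_repair (rcons s (mpolyC 2 a + b *: s`_i + c *: s`_j))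
| repair_drop (s s' : seq (mpoly 2 K)) :
    linear_repair s -> subseq s' s -> linear_repair s'.

Definition embeds_plane (s : seq (mpoly 2 K)) : Prop :=
  injective (fun x : 'rV[K]_2 => [seq meval (x ord0) f | f <- s]).

End LinearReembeddings.

Arguments trop_curve {R} g s.

(* Main.v *)
Require Import Defs.
From HB Require Import structures.
From mathcomp Require Import all_boot all_order all_algebra.
From mathcomp Require Import boolp classical_sets functions fsbigop.
From mathcomp Require Import reals ereal topology normedtype.
From mathcomp Require Import complex.
From mathcomp Require Import lra ring zify.
From mathcomp Require Import -(notations) mpoly.
Import Order.TTheory GRing.Theory Num.Theory.
Import numFieldNormedType.Exports.
Local Open Scope classical_set_scope.
Local Open Scope ring_scope.

(* As val j < 0, the Weierstrass cubic degenerates to a node: with l1, l2 the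
   tangents at the node, z = (l2 - l1) / 2 and v = - val j, an affine
   substitution turns it into 3 l1 l2 = z^3 + 3 eps z + eps with val eps = v.
   Along the points with 0 < val z < v / 2 the pair (val l1, val l2) runs through
   the triangle with vertices (0, 0), (2 v / 3, v / 3), (v / 3, 2 v / 3), whose
   lattice length is v.  The line at infinity of the given plane is
   lambda = c0 + c1 l1 + c2 l2, and 1 / lambda, l1 / lambda, l2 / lambda are
   affine-linear in the given coordinates.  No edge of the triangle is parallel
   to a ray of the tropical line of lambda, so val lambda is the tropical form
   min (val c0, val c1 + val l1, val c2 + val l2) at all but finitely many points
   of the triangle: in these three coordinates the triangle lifts to a cycle
   of the same lattice length. *)

Set Implicit Arguments.
Unset Strict Implicit.

(** * Valuations and leading coefficients of Puiseux series *)

Section Valuations.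
Variable F : fieldType.
Implicit Types (f g h : puiseux F) (p q : rat).

(** Valuations are kept as relations with rational bounds: lower bounds then combine without a
    separate case for the zero series, which satisfies every [val_ge]. *)
Definition val_ge f p : Prop := forall q, q < p -> f q = 0.
Definition val_eq f p : Prop := f p != 0 /\ val_ge f p.

Lemma pcoefD f g q : (f + g) q = f q + g q.
Proof. by []. Qed.

Lemma pcoefN f q : (- f) q = - f q.
Proof. by []. Qed.

Lemma pcoefM f g q :
  (f * g) q = \sum_(p \in [set: rat]) f p * g (q - p).
Proof. by []. Qed.

Lemma val_ge0 p : val_ge 0 p.
Proof. by []. Qed.

Lemma val_ge_trans f p q : p <= q -> val_ge f q -> val_ge f p.
Proof. by move=> pq fq r rp; apply/fq/(lt_le_trans rp). Qed.

Lemma val_geD f g p : val_ge f p -> val_ge g p -> val_ge (f + g) p.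
Proof. by move=> fp gp q qp; rewrite pcoefD fp// gp// addr0. Qed.

Lemma pcoefM_lead f g p q : val_ge f p -> val_ge g q ->
  (f * g) (p + q) = f p * g q.
Proof.
move=> fp gq; rewrite pcoefM -(fsbig_widen [set p])//.
  by rewrite fsbig_set1 addrC addKr.
move=> r [_ /= /eqP rp]; move: rp; rewrite neq_lt => /orP[rp|rp].
  by rewrite fp// mul0r.
by rewrite gq ?mulr0//; lra.
Qed.

Lemma val_geM f g p q : val_ge f p -> val_ge g q -> val_ge (f * g) (p + q).
Proof.
move=> fp gq r rpq; rewrite pcoefM fsbig1// => s _.
have [sp|ps] := ltP s p; first by rewrite fp// mul0r.
by rewrite gq ?mulr0//; lra.
Qed.

Lemma val_eqM f g p q : val_eq f p -> val_eq g q -> val_eq (f * g) (p + q).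
Proof.
move=> [f0 fp] [g0 gq]; split; last exact: val_geM.
by rewrite pcoefM_lead// mulf_neq0.
Qed.

Lemma val_eqDl f g p q : p < q -> val_eq f p -> val_ge g q -> val_eq (f + g) p.
Proof.
move=> pq [f0 fp] gq; split; first by rewrite pcoefD gq// addr0.
by apply: val_geD => //; apply: val_ge_trans gq; exact: ltW.
Qed.

Lemma val_eqN f p : val_eq f p -> val_eq (- f) p.
Proof.
by move=> [f0 fp]; split=> [|q /fp fq]; rewrite pcoefN ?oppr_eq0// fq oppr0.
Qed.

Lemma val_eq_neq0 f p : val_eq f p -> f != 0.
Proof. by move=> [f0 _]; apply: contra_neq f0 => ->. Qed.

Lemma val_eq_uniq f p q : val_eq f p -> val_eq f q -> p = q.
Proof.
move=> [fp0 fp] [fq0 fq]; have [pq|qp|//] := ltrgtP p q.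
- by rewrite fq ?eqxx in fp0.
- by rewrite fp ?eqxx in fq0.
Qed.

Lemma val_eq_ex f : f != 0 -> exists p, val_eq f p.
Proof.
move=> /lead_pser[n [m [a [a0 fE]]]]; exists (expo n m 0); rewrite /val_eq /val_ge.
rewrite fE pserE; split=> // q; apply: contra_ltP => /eqP/pser_exps[k ->].
by rewrite /expo ler_pM2r ?invr_gt0 ?ltr0n// lerD2l ler_nat.
Qed.

Lemma pcoef_nat n q : (n%:R : puiseux F) q = n%:R * (q == 0)%:R.
Proof.
elim: n => [|n IH]; first by rewrite mul0r.
by rewrite -!natr1 pcoefD IH mulrDl mul1r.
Qed.

Lemma val_ge_nat n : val_ge n%:R 0.
Proof. by move=> q q0; rewrite pcoef_nat lt_eqF// mulr0. Qed.

Lemma val_eq_nat n : (n%:R : F) != 0 -> val_eq n%:R 0.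
Proof. by move=> n0; split; [rewrite pcoef_nat eqxx mulr1|exact: val_ge_nat]. Qed.

Lemma val_eqV f p : val_eq f p -> val_eq f^-1 (- p).
Proof.
move=> fp; have f0 := val_eq_neq0 fp.
have [q fq] := val_eq_ex (invr_neq0 f0).
suff -> : - p = q by [].
have := val_eqM fp fq; rewrite divff//.
move=> /val_eq_uniq/(_ (val_eq_nat (n := 1) (oner_neq0 _))).
by move/eqP; rewrite addr_eq0 => /eqP ->; rewrite opprK.
Qed.

Lemma val_eq_div f g p q : val_eq f p -> val_eq g q -> val_eq (f / g) (p - q).
Proof. by move=> fp gq; apply/val_eqM => //; exact: val_eqV. Qed.

(** * Monomials and square roots *)

Definition mono_fun (c : F) (q : rat) : rat -> F := fun p => c * (p == q)%:R.

Lemma mono_puiseux c q : is_puiseux (mono_fun c q).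
Proof.
apply/asboolP; exists (absz (denq q)).-1, (numq q) => p.
rewrite /mono_fun; have [->|_] := eqVneq p q; last by rewrite mulr0 eqxx.
move=> _; exists 0%N; rewrite /expo addr0 prednK ?absz_gt0 ?denq_neq0//.
by rewrite -[LHS]divq_num_den -[X in _ / X%:~R](gez0_abs (denq_ge0 q)).
Qed.

Definition mono c q : puiseux F := Puiseux (mono_puiseux c q).

Lemma val_ge_mono c q : val_ge (mono c q) q.
Proof. by move=> p pq; rewrite /= /mono_fun lt_eqF// mulr0. Qed.

Lemma mono_lead c q : mono c q q = c.
Proof. by rewrite /= /mono_fun eqxx mulr1. Qed.

Lemma val_eq_mono c q : c != 0 -> val_eq (mono c q) q.
Proof. by move=> c0; split; [rewrite mono_lead|exact: val_ge_mono]. Qed.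

Lemma monoM c d p q : mono c p * mono d q = mono (c * d) (p + q).
Proof.
apply: puiseuxP; apply/funext => r; rewrite pcoefM -(fsbig_widen [set p])//.
  rewrite fsbig_set1 /= /mono_fun eqxx mulr1 mulrA subr_eq addrC; reflexivity.
by move=> s [_ /= /eqP sp]; rewrite /mono_fun (negbTE sp) mulr0 mul0r.
Qed.

Lemma puiseux_nat_neq0 n : (n%:R : F) != 0 -> (n%:R : puiseux F) != 0.
Proof. by move=> /val_eq_nat/val_eq_neq0. Qed.

(** The root has constant term 1, so in the coefficient of index [l] of its square the unknown of
    index [l] occurs only in the two end terms; this gives the division by 2. *)
Fixpoint sqrt_coefs (a : nat -> F) (k : nat) : seq F :=
  if k is l.+1 then
    let s := sqrt_coefs a l in
    rcons s (if l is i.+1 then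
      (a l - \sum_(i0 < i) s`_i0.+1 * s`_(i - i0)) / 2 else 1)
  else [::].

Lemma size_sqrt_coefs a k : size (sqrt_coefs a k) = k.
Proof. by elim: k => //= k IH; rewrite size_rcons IH. Qed.

Lemma sqrt_coefs_nth a k i : (i < k)%N ->
  (sqrt_coefs a k)`_i = (sqrt_coefs a i.+1)`_i.
Proof.
elim: k => // k IH; rewrite ltnS leq_eqVlt => /predU1P[->//|ik].
by rewrite [LHS]/= nth_rcons size_sqrt_coefs ik IH.
Qed.

Lemma conv_sqrt a : (2 : F) != 0 -> a 0%N = 1 ->
  let b := fun k => (sqrt_coefs a k.+1)`_k in conv b b = a.
Proof.
move=> F2 a0 b; apply/funext => -[|k]; rewrite /conv.
  by rewrite big_ord_recl big_ord0 /b/= addr0 mulr1.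
rewrite big_ord_recl big_ord_recr/= subn0 subnn /bump/= add1n.
have -> : b 0%N = 1 by [].
have -> : b k.+1 = (a k.+1 - \sum_(i < k) b i.+1 * b (k - i)%N) / 2.
  rewrite {1}/b [sqrt_coefs _ _]/= nth_rcons.
  have -> : size (sqrt_coefs a k.+1) = k.+1 by exact: size_sqrt_coefs.
  rewrite ltnn eqxx; congr ((_ - _) / 2); apply: eq_bigr => i _.
  rewrite -/(sqrt_coefs a k.+1) [X in X * _]sqrt_coefs_nth ?ltnS//.
  by rewrite [X in _ * X]sqrt_coefs_nth ?ltnS ?leq_subr.
under eq_bigr do rewrite add1n subSS.
set S := \sum_(i < k) _; rewrite mul1r mulr1.
by field.
Qed.

Lemma sqrt_one_unit f : (2 : F) != 0 -> f 0 = 1 -> val_ge f 0 ->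
  exists g, [/\ g ^+ 2 = f, g 0 = 1 & val_ge g 0].
Proof.
move=> F2 f01 fge.
have f0 : f != 0.
  apply/eqP => f0; move: f01 (oner_neq0 F); rewrite f0 => <-.
  by rewrite eqxx.
have [n [m [a [a0 fE]]]] := lead_pser f0.
have mexp k : expo n m 0 <= expo n m k.
  by rewrite /expo ler_pM2r ?invr_gt0 ?ltr0n// lerD2l ler_nat.
(* Once the leading exponent is 0, squaring does not shift the offset [m]. *)
have m0 : m = 0.
  have : expo n m 0 = 0.
    apply: (@val_eq_uniq f); last by split=> //; rewrite f01 oner_neq0.
    rewrite /val_eq /val_ge fE pserE; split=> // q.
    by apply: contra_ltP => /eqP/pser_exps[k ->].
  move/eqP; rewrite /expo addr0 mulf_eq0 intr_eq0 => /orP[/eqP//|].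
  by rewrite invr_eq0 pnatr_eq0.
have e0 : expo n m 0 = 0 by rewrite /expo m0 addr0 mul0r.
have a1 : a 0%N = 1 by rewrite -f01 fE -e0 pserE.
exists (Puiseux (pser_puiseux n m (fun k => (sqrt_coefs a k.+1)`_k))); split.
- by apply: puiseuxP; rewrite expr2 /= mul_pser conv_sqrt// fE m0 addr0.
- by rewrite /= -e0 pserE.
- by move=> q q0; apply: contra_ltP q0 => /eqP/pser_exps[k ->]; rewrite -e0.
Qed.

End Valuations.

Lemma puiseux_sqrt (F : numClosedFieldType) (f : puiseux F) :
  exists g, g ^+ 2 = f.
Proof.
have [->|f0] := eqVneq f 0; first by exists 0; rewrite expr0n.
have [p fp] := val_eq_ex f0.
have c0 : f p != 0 by case: fp.
(* Division by the leading term leaves a series with constant term 1. The leading term has a root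
   since its coefficient has one and its exponent can be halved. *)
pose u := mono (f p)^-1 (- p) * f.
have uge : val_ge u 0.
  by rewrite -(addNr p); apply: val_geM; [exact: val_ge_mono|case: fp].
have u1 : u 0 = 1.
  rewrite -(addNr p) pcoefM_lead ?mono_lead ?mulVf//; first exact: val_ge_mono.
  by case: fp.
have F2 : (2 : F) != 0 by rewrite pnatr_eq0.
have [v [vu _ _]] := sqrt_one_unit F2 u1 uge.
exists (mono (sqrtC (f p)) (p / 2) * v).
rewrite exprMn vu /u mulrA expr2 monoM -expr2 sqrtCK -splitr monoM.
rewrite mulfV// addrN.
suff -> : mono (1 : F) 0 = 1 by rewrite mul1r.
by apply: puiseuxP; apply/funext => q; rewrite /= /mono_fun mul1r.
Qed.

Lemma pval_val_eq (R : realType) (F : fieldType) (f : puiseux F) q :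
  val_eq f q -> pval R f = (ratr q : R)%:E.
Proof.
move=> fq; have [p [f0 fp ->]] := pvalP R (val_eq_neq0 fq).
by rewrite (val_eq_uniq fq (conj f0 fp)).
Qed.

(** * Points of the nodal cubic over the triangle *)

Section NodalReduction.
Variable F : fieldType.
Hypotheses (F2 : (2 : F) != 0) (F3 : (3 : F) != 0).
Implicit Types (eps : puiseux F) (v s t : rat).

Definition nodal_cubic eps (l1 l2 : puiseux F) : Prop :=
  let z := (l2 - l1) / 2 in l1 * l2 = (z ^+ 3 + 3 * eps * z + eps) / 3.

(** This symmetry fixes both [z] and [l1 * l2]; as it exchanges the two valuations, it reflects one
    half of the triangle onto the other. *)
Lemma nodal_cubicN eps l1 l2 :
  nodal_cubic eps l1 l2 -> nodal_cubic eps (- l2) (- l1).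
Proof. by rewrite /nodal_cubic mulrNN [l2 * l1]mulrC opprK [- l1 + l2]addrC. Qed.

(** Fixing [z] as a monomial of exponent [s] leaves a quadratic equation for [l1] and [l2]. The
    condition [3 * s != v] keeps the terms [z ^+ 3] and [eps] from cancelling. *)
Lemma nodal_cubic_point eps v s : val_eq eps v -> 0 < s -> 2 * s < v -> 3 * s != v ->
  exists l1 l2, [/\ nodal_cubic eps l1 l2, val_eq l1 (Num.min (2 * s) (v - s)) &
    val_eq l2 s].
Proof.
move=> ev s0 sv s3.
have K2 := puiseux_nat_neq0 F2; have K3 := puiseux_nat_neq0 F3.
have h3 : val_eq (3%:R : puiseux F) 0 by exact: val_eq_nat.
pose z : puiseux F := mono 1 s.
have hz : val_eq z s by apply: val_eq_mono; exact: oner_neq0.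
have z0 := val_eq_neq0 hz.
(* [w] is the product [l1 * l2] prescribed by the cubic, divided by [z ^+ 2]. With
   [l1 = z * (y - 1)] and [l2 = z * (y + 1)] the equation reads [y ^+ 2 = 1 + w]; [q] is a positive
   lower bound for the valuation of [w]. *)
pose w := z / 3 + eps / z + eps / (3 * (z * z)).
pose q := Num.min s (v - 2 * s).
have q0 : 0 < q by rewrite /q lt_min; apply/andP; split; lra.
have wq : val_ge w q.
  have [q1 q2] : q <= s /\ q <= v - 2 * s by rewrite /q !ge_min !lexx orbT.
  have [_ a1] := val_eq_div hz h3.
  have [_ a2] := val_eq_div ev hz.
  have [_ a3] := val_eq_div ev (val_eqM h3 (val_eqM hz hz)).
  by apply: val_geD; [apply: val_geD|];
    [apply: val_ge_trans a1|apply: val_ge_trans a2|apply: val_ge_trans a3]; lra.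
have [||y [yE y0 yge]] := @sqrt_one_unit F (1 + w) F2.
- by rewrite pcoefD wq// addr0 (pcoef_nat F 1) eqxx mulr1.
- by apply: val_geD; [exact: (val_ge_nat F 1)|apply: val_ge_trans wq; exact: ltW].
pose l1 := z * (y - 1); pose l2 := z * (y + 1).
have lE : l1 * l2 = z ^+ 3 / 3 + (eps * z + eps / 3).
  have -> : l1 * l2 = z ^+ 2 * (y ^+ 2 - 1) by rewrite /l1 /l2; ring.
  by rewrite yE /w; field; rewrite K3.
have h2 : val_eq l2 s.
  rewrite -[s]addr0; apply: val_eqM => //; split.
    by rewrite pcoefD y0 (pcoef_nat F 1) eqxx mulr1.
  by apply: val_geD => //; exact: (val_ge_nat F 1).
have h12 : val_eq (l1 * l2) (Num.min (3 * s) v).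
  have a1 := val_eq_div (val_eqM hz (val_eqM hz hz)) h3.
  have a2 := val_eqM ev hz.
  have a3 := val_eq_div ev h3.
  have -> : l1 * l2 = z * (z * z) / 3 + (eps / 3 + eps * z) by rewrite lE; ring.
  have a23 : val_eq (eps / 3 + eps * z) v.
    by rewrite -[v]subr0; apply: val_eqDl a3 a2.2; lra.
  have [sv'|sv'] := ltP (3 * s) v.
    rewrite (_ : 3 * s = s + (s + s) - 0); last by ring.
    by apply: val_eqDl a1 a23.2; lra.
  rewrite addrC; apply: val_eqDl a23 a1.2; move: s3; rewrite neq_lt; lra.
exists l1, l2; split => //.
  have zE : (l2 - l1) / 2 = z by rewrite /l1 /l2; field.
  by rewrite /nodal_cubic zE lE; field.
(* The constant terms cancel in [y - 1], so the valuation of [l1] is deduced from those of [l1 * l2]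
   and [l2]. *)
have l10 : l1 != 0.
  by apply: contraTneq (val_eq_neq0 h12) => ->; rewrite mul0r eqxx.
have [p hp] := val_eq_ex l10.
have := val_eq_uniq h12 (val_eqM hp h2) => pE.
suff -> : Num.min (2 * s) (v - s) = p by [].
by move: pE; case: ltP => ?; case: ltP => ?; lra.
Qed.

(** The boundary of the triangle is parametrised by lattice length, for [t] from 0 to [v]: the
    successive edges have the primitive directions (2, 1), (-1, 1) and (-1, -2). *)
Definition triangle1 (T : realDomainType) (v t : T) := Num.min (2 * t) (v - t).
Definition triangle2 (T : realDomainType) (v t : T) := Num.min t (2 * (v - t)).

(** Below [v / 2] the exponent of [z] is [t]; above, it is [v - t] and the symmetry is applied. The
    excluded parameters are two vertices and the point where the halves meet. *)
Lemma nodal_cubic_triangle eps v t : val_eq eps v -> 0 < t -> t < v ->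
    3 * t != v -> 2 * t != v -> 3 * t != 2 * v ->
  exists l1 l2, [/\ nodal_cubic eps l1 l2, val_eq l1 (triangle1 v t) &
    val_eq l2 (triangle2 v t)].
Proof.
move=> ev t0 tv t3 t2 t23; rewrite /triangle1 /triangle2.
move: t2; rewrite neq_lt => /orP[t2|t2].
  have [l1 [l2 [H h1 h2]]] := nodal_cubic_point ev t0 t2 t3.
  by exists l1, l2; split=> //; rewrite min_l//; lra.
have [|||l1 [l2 [H h1 h2]]] := @nodal_cubic_point eps v (v - t) ev; [lra|lra| |].
  by apply: contra_neq t23; lra.
exists (- l2), (- l1); split; [exact: nodal_cubicN|rewrite min_r; [exact: val_eqN|lra]|].
apply: val_eqN; rewrite (_ : Num.min t _ = Num.min (2 * (v - t)) (v - (v - t)))//.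
by rewrite minC; congr Num.min; lra.
Qed.

End NodalReduction.

(** * The tropical form of lambda along the triangle *)

Lemma val_eq_sum3 (F : fieldType) (x y z : puiseux F) p q r :
  val_eq x p -> val_ge y q -> val_ge z r -> p < q -> p < r ->
  val_eq (x + (y + z)) p.
Proof.
move=> xp yq zr pq pr; apply: (@val_eqDl _ _ _ _ (Num.min q r)) => //.
  by rewrite lt_min pq.
by apply: val_geD; [apply: val_ge_trans yq|apply: val_ge_trans zr];
  rewrite ge_min lexx ?orbT.
Qed.

Definition trop_form (T : realDomainType) (e0 e1 e2 v t : T) :=
  Num.min e0 (Num.min (e1 + triangle1 v t) (e2 + triangle2 v t)).

Definition unique_min (T : realDomainType) (x y z : T) : Prop :=
  [\/ x < y /\ x < z, y < x /\ y < z | z < x /\ z < y].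

(** As [d1] divides 2, the only zero is an integer and so avoids the open unit interval. The sign is
    chosen before the field [T], hence is common to rational and real parameters. *)
Lemma no_sign_change (d0 d1 : int) (i : nat) :
    d1 \in [:: 1; -1; 2; -2] ->
  (forall (T : realFieldType) (t : T), i%:R <= t <= i.+1%:R ->
     let y := (2 * d0)%:~R + d1%:~R * t in
     0 <= y /\ (i%:R < t < i.+1%:R -> 0 < y)) \/
  (forall (T : realFieldType) (t : T), i%:R <= t <= i.+1%:R ->
     let y := (2 * d0)%:~R + d1%:~R * t in
     y <= 0 /\ (i%:R < t < i.+1%:R -> y < 0)).
Proof.
rewrite !inE => d1E.
have [H|H] : (0 <= 2 * d0 + d1 * i%:Z /\ 0 <= 2 * d0 + d1 * i.+1%:Z) \/
  (2 * d0 + d1 * i%:Z <= 0 /\ 2 * d0 + d1 * i.+1%:Z <= 0).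
- case/or4P: d1E => /eqP ->; lia.
- left=> T t it y; move: H; rewrite -!(ler_int T) !rmorphD !rmorphM/= -!pmulrn -natr1.
  move: it; rewrite -natr1 /y rmorphM/= => /andP[it ti].
  by case/or4P: d1E => /eqP -> [H1 H2]; split=> [|/andP[]]; lra.
- right=> T t it y; move: H; rewrite -!(ler_int T) !rmorphD !rmorphM/= -!pmulrn -natr1.
  move: it; rewrite -natr1 /y rmorphM/= => /andP[it ti].
  by case/or4P: d1E => /eqP -> [H1 H2]; split=> [|/andP[]]; lra.
Qed.

(** For [v = 6 * z] the vertices sit at 0, [2 * z] and [4 * z], so none lies inside a unit
    interval. *)
Lemma triangle_cell (z i : nat) :
  exists a1 b1 a2 b2 : int, (a1, a2) \in [:: (2, 1); (-1, 1); (-1, -2)] /\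
    forall (T : realFieldType) (t : T), i%:R <= t <= i.+1%:R ->
      triangle1 (6 * z)%:R t = (6 * b1)%:~R + a1%:~R * t /\
      triangle2 (6 * z)%:R t = (6 * b2)%:~R + a2%:~R * t.
Proof.
have natE (T : realFieldType) k : (2 * z * k)%:R = 2 * k%:R * z%:R :> T.
  by rewrite !natrM; ring.
have [iz|zi] := ltnP i (2 * z * 1).
  exists 2, 0, 1, 0; split=> // T t /andP[it ti].
  have z0 := ler0n T z; rewrite /triangle1 /triangle2.
  move: iz; rewrite -(ler_nat T) natE => iz.
  by rewrite !min_l; [split| |]; rewrite ?natrM; lra.
have [iz|zi'] := ltnP i (2 * z * 2).
  exists (-1), z%:Z, 1, 0; split=> // T t /andP[it ti].
  have z0 := ler0n T z; rewrite /triangle1 /triangle2.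
  move: iz zi; rewrite -(ler_nat T) -(ler_nat T (2 * z * 1)) !natE => iz zi1.
  by rewrite min_r ?min_l; [split| |]; rewrite ?natrM ?rmorphM/= -?pmulrn; lra.
exists (-1), z%:Z, (-2), (2 * z%:Z); split=> // T t /andP[it ti].
have z0 := ler0n T z; rewrite /triangle1 /triangle2.
move: zi'; rewrite -(ler_nat T) natE => zi2.
by rewrite !min_r; [split| |]; rewrite ?natrM ?rmorphM/= -?pmulrn; lra.
Qed.

(* No edge of the triangle is parallel to a ray of the tropical line of the
   form, and the factor [6] puts all bends at integers. *)
Lemma trop_form_cell (z i : nat) (e0 e1 e2 : int) :
  exists a1 b1 a2 b2 a b : int,
  gcdn `|a| (gcdn `|a - a1| `|a - a2|) = 1%N /\
  forall (T : realFieldType) (t : T), i%:R <= t <= i.+1%:R ->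
    let v := (6 * z)%:R in
    let f0 := (6 * e0)%:~R in let f1 := (6 * e1)%:~R in let f2 := (6 * e2)%:~R in
    [/\ triangle1 v t = b1%:~R + a1%:~R * t, triangle2 v t = b2%:~R + a2%:~R * t,
        trop_form f0 f1 f2 v t = b%:~R + a%:~R * t &
        i%:R < t < i.+1%:R ->
          unique_min f0 (f1 + triangle1 v t) (f2 + triangle2 v t)].
Proof.
have [a1 [b1 [a2 [b2 [aE abP]]]]] := triangle_cell z i.
have [h1 h2 h3] : [/\ a1 \in [:: 1; -1; 2; -2], a2 \in [:: 1; -1; 2; -2]
    & a1 - a2 \in [:: 1; -1; 2; -2]].
  by move: aE; rewrite !inE => /or3P[] /eqP[-> ->].
(* The three terms of the form are compared in pairs; the factor 6 is split as 2 times 3 to exhibit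
   an even constant term. *)
have D1 := no_sign_change (3 * (e1 + b1 - e0)) i h1.
have D2 := no_sign_change (3 * (e2 + b2 - e0)) i h2.
have D3 := no_sign_change (3 * (e1 + b1 - e2 - b2)) i h3.
(* The edge in space has direction [(a, a - a1, a - a2)], where [a] is the slope of the minimal
   term: 0, [a1] or [a2]. It is primitive in each case. *)
have g0 : gcdn `|0| (gcdn `|0 - a1| `|0 - a2|) = 1%N.
  by move: aE; rewrite !inE => /or3P[] /eqP[-> ->].
have g1 : gcdn `|a1| (gcdn `|a1 - a1| `|a1 - a2|) = 1%N.
  by move: aE; rewrite !inE => /or3P[] /eqP[-> ->].
have g2 : gcdn `|a2| (gcdn `|a2 - a1| `|a2 - a2|) = 1%N.
  by move: aE; rewrite !inE => /or3P[] /eqP[-> ->].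
exists a1, (6 * b1), a2, (6 * b2).
have main a b : gcdn `|a| (gcdn `|a - a1| `|a - a2|) = 1%N ->
  (forall (T : realFieldType) (t : T), i%:R <= t <= i.+1%:R ->
    let f0 := (6 * e0)%:~R in
    let f1 := (6 * e1)%:~R + ((6 * b1)%:~R + a1%:~R * t) in
    let f2 := (6 * e2)%:~R + ((6 * b2)%:~R + a2%:~R * t) in
    let f := b%:~R + a%:~R * t in
    [/\ f <= f0, f <= f1, f <= f2, [\/ f = f0, f = f1 | f = f2] &
      i%:R < t < i.+1%:R -> unique_min f0 f1 f2]) ->
  exists a b : int,
  gcdn `|a| (gcdn `|a - a1| `|a - a2|) = 1%N /\
  forall (T : realFieldType) (t : T), i%:R <= t <= i.+1%:R ->
    let v := (6 * z)%:R in
    let f0 := (6 * e0)%:~R in let f1 := (6 * e1)%:~R in let f2 := (6 * e2)%:~R in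
    [/\ triangle1 v t = (6 * b1)%:~R + a1%:~R * t,
        triangle2 v t = (6 * b2)%:~R + a2%:~R * t,
        trop_form f0 f1 f2 v t = b%:~R + a%:~R * t &
        i%:R < t < i.+1%:R ->
          unique_min f0 (f1 + triangle1 v t) (f2 + triangle2 v t)].
  move=> g H; exists a, b; split=> // T t it v f0 f1 f2.
  have [t1 t2] := abP T t it; rewrite /trop_form t1 t2.
  have [l0 l1 l2 e u] := H T t it; split=> //.
  apply/eqP; rewrite eq_le !le_min l0 l1 l2 andbT.
  by rewrite !ge_min; case: e => ->; rewrite lexx ?orbT.
have [[K0 K1] K2] := (main 0 (6 * e0) g0, main a1 (6 * (e1 + b1)) g1,
  main a2 (6 * (e2 + b2)) g2).
(* Six sign patterns order the terms and name a minimal one. The fourth and fifth are cyclic: they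
   force all terms to agree, which the strict signs exclude inside the interval. *)
case: D1 => D1; case: D2 => D2; case: D3 => D3;
  [apply: K0|apply: K0|apply: K2|apply: K0|apply: K0|apply: K1|apply: K2|apply: K1];
  move=> T t it f0 f1 f2 f; move: (D1 T t it) (D2 T t it) (D3 T t it);
  (have -> : (2 * (3 * (e1 + b1 - e0)))%:~R + a1%:~R * t = f1 - f0
     by rewrite /f1 /f0 !rmorphM !(rmorphB, rmorphD)/=; ring);
  (have -> : (2 * (3 * (e2 + b2 - e0)))%:~R + a2%:~R * t = f2 - f0
     by rewrite /f2 /f0 !rmorphM !(rmorphB, rmorphD)/=; ring);
  (have -> : (2 * (3 * (e1 + b1 - e2 - b2)))%:~R + (a1 - a2)%:~R * t = f1 - f2
     by rewrite /f1 /f2 !rmorphM !(rmorphB, rmorphD)/=; ring);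
  (have [g0E g1E g2E] : [/\ (6 * e0)%:~R + 0%:~R * t = f0,
     (6 * (e1 + b1))%:~R + a1%:~R * t = f1 &
     (6 * (e2 + b2))%:~R + a2%:~R * t = f2]
     by rewrite /f0 /f1 /f2 !rmorphM !rmorphD/=; split; ring);
  rewrite /f ?g0E ?g1E ?g2E; move: (f0) (f1) (f2) (i%:R < t < i.+1%:R);
  clear; move=> x y w o [s1 o1] [s2 o2] [s3 o3];
  (split; [lra|lra|lra|
    first [exact: (Or31 _ _ erefl)|exact: (Or32 _ _ erefl)|exact: (Or33 _ _ erefl)]|]);
  move=> oo; move: (o1 oo) (o2 oo) (o3 oo) => {}o1 {}o2 {}o3;
  first [by apply: Or31; split; lra | by apply: Or32; split; lra
       | by apply: Or33; split; lra | lra].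
Qed.

(** * From rational points to a closed polygon *)

Lemma segment_sub_closure (R : realType) n (p q : 'rV[R]_n) (S : set 'rV[R]_n) :
  (forall r : rat, 0 < r < 1 -> S ((1 - ratr r) *: p + ratr r *: q)) ->
  segment p q `<=` closure S.
Proof.
move=> HS _ [t /= /andP[t0 t1] <-] B /nbhs_ballP[e /= e0 eB].
(* [c] exceeds every coordinate of [q - p] in absolute value, so a parameter change below [e / c]
   keeps the point in the ball of radius [e]. *)
pose c := 1 + \sum_j `|q ord0 j - p ord0 j|.
have c0 : 0 < c by rewrite ltr_pwDl// sumr_ge0.
have ec0 : 0 < e / c by rewrite divr_gt0.
have [r /andP[]] : exists r : rat,
    (ratr r : R) \in `]Num.max 0 (t - e / c), Num.min 1 (t + e / c)[.
  apply: rat_in_itvoo.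
  by rewrite gt_max !lt_min; apply/andP; split; apply/andP; split; lra.
rewrite bnd_simp gt_max => /andP[r0 rt]; rewrite bnd_simp lt_min => /andP[r1 tr].
exists ((1 - ratr r) *: p + ratr r *: q); split.
  by apply: HS; rewrite -!(ltr_rat R) (rmorph0 (@ratr R)) (rmorph1 (@ratr R)) r0.
apply: eB; split=> // i j; rewrite ord1 !mxE /ball/=.
rewrite (_ : _ - _ = (t - ratr r) * (q ord0 j - p ord0 j)); last by ring.
rewrite normrM; have tr' : `|t - ratr r| < e / c by rewrite ltr_norml; lra.
have qc : `|q ord0 j - p ord0 j| < c.
  by rewrite /c (bigD1 j)//= addrCA ltrDl ltr_pwDl// sumr_ge0.
rewrite -[ltRHS](divfK (lt0r_neq0 c0)) ltr_pM//.
Qed.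

(** Up to the scale [d] applied later, these are the negated valuations of 1 / lambda, l1 / lambda
    and l2 / lambda when lambda has valuation [m]. *)
Definition trop_point (T : realFieldType) (z : nat) (e0 e1 e2 : int) (t : T) :
    'rV[T]_3 :=
  let v := (6 * z)%:R in
  let m := trop_form (6 * e0)%:~R (6 * e1)%:~R (6 * e2)%:~R v t in
  \row_k [:: m; m - triangle1 v t; m - triangle2 v t]`_k.

Lemma trop_point_interp (T : realFieldType) z e0 e1 e2 (i : nat) (t : T) :
  0 <= t <= 1 -> trop_point z e0 e1 e2 (i%:R + t) =
    (1 - t) *: trop_point z e0 e1 e2 i%:R + t *: trop_point z e0 e1 e2 i.+1%:R.
Proof.
move=> /andP[t0 t1].
have [a1 [b1 [a2 [b2 [a [b [_ H]]]]]]] := trop_form_cell z i e0 e1 e2.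
have [|x1 x2 x _] := H T (i%:R + t); first by rewrite -natr1; apply/andP; split; lra.
have [|y1 y2 y _] := H T i%:R; first by rewrite -natr1; apply/andP; split; lra.
have [|w1 w2 w _] := H T i.+1%:R; first by rewrite -natr1; apply/andP; split; lra.
apply/rowP => k; rewrite !mxE /= x1 x2 x y1 y2 y w1 w2 w -natr1.
by case: k => -[|[|[|//]]] /= _; ring.
Qed.

Lemma trop_point_period (T : realFieldType) z e0 e1 e2 :
  trop_point z e0 e1 e2 (6 * z)%:R = trop_point z e0 e1 e2 0 :> 'rV[T]_3.
Proof.
have z0 : 0 <= (6 * z)%:R :> T by exact: ler0n.
rewrite /trop_point /trop_form /triangle1 /triangle2.
have -> : Num.min (2 * (6 * z)%:R) ((6 * z)%:R - (6 * z)%:R) =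
    Num.min (2 * 0) ((6 * z)%:R - 0) :> T.
  by rewrite min_r ?min_l; lra.
have -> : Num.min (6 * z)%:R (2 * ((6 * z)%:R - (6 * z)%:R)) =
    Num.min 0 (2 * ((6 * z)%:R - 0)) :> T.
  by rewrite min_r ?min_l; lra.
by [].
Qed.

(** Subtracting the other coordinates from the first recovers the point of the triangle, whose
    boundary is traversed once. *)
Lemma trop_point_inj (T : realFieldType) z e0 e1 e2 (t u : T) :
  0 <= t -> t <= u -> u <= (6 * z)%:R ->
  trop_point z e0 e1 e2 t = trop_point z e0 e1 e2 u ->
  t = u \/ t = 0 /\ u = (6 * z)%:R.
Proof.
move=> t0 tu uz /rowP E; move: (E 0) (E 1) (E 2); rewrite !mxE /=.
move=> -> /addrI/oppr_inj + /addrI/oppr_inj.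
rewrite /triangle1 /triangle2.
case: (ltP (2 * t)) => h1; case: (ltP t) => h2;
  case: (ltP (2 * u)) => h3; case: (ltP u) => h4 E1 E2;
  first [by left; lra | by right; split; lra].
Qed.

Lemma map_trop_point (R : realType) z e0 e1 e2 (i : nat) (t : rat) :
  i%:R <= t <= i.+1%:R ->
  map_mx ratr (trop_point z e0 e1 e2 t) = trop_point z e0 e1 e2 (ratr t) :> 'rV[R]_3.
Proof.
move=> /andP[it ti].
have [a1 [b1 [a2 [b2 [a [b [_ H]]]]]]] := trop_form_cell z i e0 e1 e2.
have [|x1 x2 x _] := H rat t; first by rewrite it.
have [|y1 y2 y _] := H R (ratr t).
  by rewrite -!(ratr_nat R) !ler_rat it.
apply/rowP => k; rewrite !mxE /= x1 x2 x y1 y2 y.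
by case: k => -[|[|[|//]]] /= _;
  rewrite ?(rmorphB (@ratr R)) !(rmorphD (@ratr R)) !(rmorphM (@ratr R)) /= !ratr_int.
Qed.

(** The polygon has a vertex at every integer parameter, bend or not, so that each of its [6 * z]
    edges is straight with lattice length [d]. *)
Lemma trop_point_cycle (R : realType) z (d : rat) e0 e1 e2 (S : set 'rV[R]_3) :
  (0 < z)%N -> 0 < d ->
  (forall (i : nat) (t : rat), (i < 6 * z)%N -> i%:R < t < i.+1%:R ->
     S (ratr d *: map_mx ratr (trop_point z e0 e1 e2 t))) ->
  contains_cycle (closure S) (ratr (d * (6 * z)%:R)).
Proof.
move=> z0 d0 HS.
have dR0 : 0 < ratr d :> R by rewrite ltr0q.
pose P (t : R) := ratr d *: trop_point z e0 e1 e2 t.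
have PS i t : 0 <= t <= 1 -> (1 - t) *: P i%:R + t *: P i.+1%:R = P (i%:R + t).
  move=> t01; rewrite /P trop_point_interp// scalerDr !scalerA.
  by rewrite ![_ * ratr d]mulrC.
pose p (i : 'I_(6 * z)) := P i%:R.
have pS i : p (ordS i) = P i.+1%:R.
  rewrite /p /=; have := ltn_ord i; rewrite leq_eqVlt => /predU1P[iE|iN].
    by rewrite iE modnn /P trop_point_period.
  by rewrite modn_small.
have segP i x : segment (p i) (p (ordS i)) x ->
    exists t, [/\ i%:R <= t, t <= i.+1%:R & x = P t].
  rewrite pS => -[t /= t01 <-]; rewrite PS//; exists (i%:R + t).
  by case/andP: t01 => t0' t1'; rewrite -natr1; split=> //; lra.
exists (6 * z)%N, p, (fun=> ratr d); split.
- by lia.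
- move=> i; rewrite pS; apply: segment_sub_closure => r /andP[r0 r1].
  have r01 : 0 <= (ratr r : R) <= 1.
    by rewrite ler0q (ltW r0) -(rmorph1 (@ratr R)) ler_rat ltW.
  rewrite PS//.
  have -> : i%:R + ratr r = ratr (i%:R + r) :> R by rewrite rmorphD/= ratr_nat.
  rewrite /P -(@map_trop_point _ _ _ _ _ i) -?natr1; last by apply/andP; split; lra.
  by apply: HS => //; rewrite -natr1; apply/andP; split; lra.
- have main (i j : 'I_(6 * z)) x : (i < j)%N ->
    segment (p i) (p (ordS i)) x -> segment (p j) (p (ordS j)) x ->
    j = ordS i /\ x = p j \/ i = ordS j /\ x = p i.
    move=> ij /segP[t [it ti xt]] /segP[u [ju uj xu]].
    have ij' : i.+1%:R <= j%:R :> R by rewrite ler_nat.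
    have jz : j.+1%:R <= (6 * z)%:R :> R by rewrite ler_nat.
    have i0 : 0 <= i%:R :> R by exact: ler0n.
    have /trop_point_inj : trop_point z e0 e1 e2 t = trop_point z e0 e1 e2 u.
      by apply: (scalerI (lt0r_neq0 dR0)); rewrite -/(P t) -/(P u) -xt.
    (* Either the parameters agree, and the edges share the vertex between them, or the point closes
       the polygon, between the first and the last edge. *)
    case=> [||| tu|[tE uE]]; [lra|lra|lra|left|right].
      have jE : j = i.+1 :> nat.
        by apply/eqP; rewrite eqn_leq ij andbT -(ler_nat R); lra.
      split; last by rewrite xu /p; congr P; lra.
      by apply/val_inj; rewrite /= -jE modn_small.
    have iE : i = 0%N :> nat by apply/eqP; rewrite -leqn0 -(ler_nat R); lra.
    have jE : j.+1 = (6 * z)%N.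
      by apply/eqP; rewrite eqn_leq ltn_ord -(ler_nat R); lra.
    split; last by rewrite xt /p tE iE.
    by apply/val_inj; rewrite /= jE modnn.
  move=> i j x; rewrite -val_eqE neq_ltn => /orP[ij|ji] xi xj.
    exact: main.
  by have [] := main _ _ _ ji xj xi; [right|left].
- move=> i; split=> //.
  have [a1 [b1 [a2 [b2 [a [b [g H]]]]]]] := trop_form_cell z i e0 e1 e2.
  exists (\row_k [:: a; a - a1; a - a2]`_k).
    by rewrite /primitive !big_ord_recl big_ord0 !mxE /= gcdn0.
  have [|x1 x2 x _] := H R i%:R; first by rewrite lexx ler_nat leqnSn.
  have [|y1 y2 y _] := H R i.+1%:R; first by rewrite lexx ler_nat leqnSn.
  rewrite pS /p /P -scalerBr; congr (_ *: _).
  apply/rowP => k; rewrite !mxE /= x1 x2 x y1 y2 y -natr1.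
  by case: k => -[|[|[|//]]] /= _; rewrite ?rmorphB/=; ring.
- by rewrite (rmorphM (@ratr R)) /= ratr_nat mulr_natr sumr_const card_ord.
Qed.

(** * Integral parameters and lifting of the triangle *)

Lemma common_denominator (s : seq rat) :
  exists2 M, (0 < M)%N & forall q, q \in s -> exists n : int, q = n%:~R / M%:R.
Proof.
elim: s => [|q s [M M0 IH]]; first by exists 1%N.
exists (M * absz (denq q))%N; first by rewrite muln_gt0 M0 absz_gt0 denq_neq0.
have M0' : M%:R != 0 :> rat by rewrite pnatr_eq0 -lt0n.
have d0 : (denq q)%:~R != 0 :> rat by rewrite intr_eq0 denq_neq0.
have dE : (absz (denq q))%:R = (denq q)%:~R :> rat.
  by rewrite pmulrn gez0_abs ?denq_ge0.
move=> r; rewrite in_cons natrM dE => /predU1P[->|/IH[n ->]].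
  exists (numq q * M%:Z); rewrite -{1}[q]divq_num_den rmorphM/= -pmulrn.
  by field; rewrite M0' d0.
exists (n * denq q); rewrite rmorphM/=.
by field; rewrite M0' d0.
Qed.

(* A zero coefficient, of valuation infinity, receives an exponent that is too
   large to contribute to the tropical form on the triangle. *)
Definition adapted (F : fieldType) (c : 'I_3 -> puiseux F) (d : rat) (z : nat)
    (e : 'I_3 -> int) : Prop :=
  forall k, (c k != 0 -> val_eq (c k) (d * (6 * e k)%:~R)) /\
    (c k = 0 -> exists l, e l + z%:Z < e k).

Lemma adapted_ex (F : fieldType) (c : 'I_3 -> puiseux F) (v : rat) :
  0 < v -> (exists k, c k != 0) ->
  exists d z e, [/\ 0 < d, (0 < z)%N, v = d * (6 * z)%:R & adapted c d z e].
Proof.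
move=> v0 [k0 ck0].
have /choice[q qP] : forall k, exists q, c k != 0 -> val_eq (c k) q.
  move=> k; have [_|/val_eq_ex[q cq]] := eqVneq (c k) 0; first by exists 0.
  by exists q.
have [M M0 H] := common_denominator (v :: [seq q k | k <- enum 'I_3]).
have M0' : 0 < M%:R :> rat by rewrite ltr0n.
have /choice[n nP] : forall k, exists n : int, q k = n%:~R / M%:R.
  by move=> k; apply: H; rewrite in_cons map_f ?orbT// mem_enum.
have [nv vE] := H v (mem_head _ _).
have nv0 : 0 < nv.
  by move: v0; rewrite vE pmulr_lgt0 ?invr_gt0// ltr0z.
(* With [M] a common denominator, [d = 1 / (6 * M)] makes all data integral with the factor 6 to
   spare. The default for a zero coefficient is one more than the bound set by the nonzero
   coefficient [c k0]. *)
exists (6 * M%:R)^-1, (absz nv), (fun k => if c k == 0 then n k0 + nv + 1 else n k).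
split.
- by rewrite invr_gt0; lra.
- by rewrite absz_gt0 gt_eqF.
- rewrite natrM [(absz nv)%:R]pmulrn gez0_abs ?ltW// vE.
  by field; rewrite gt_eqF.
move=> k; split=> [ck|ck]; last first.
  exists k0; rewrite ck eqxx (negbTE ck0) gez0_abs ?ltW//; lia.
rewrite (negbTE ck) (_ : _ * _ = q k); first exact: qP.
by rewrite nP rmorphM/=; field; rewrite gt_eqF.
Qed.

Lemma ord3E (k : 'I_3) : [\/ k = 0, k = 1 | k = 2].
Proof.
by case: k => -[|[|[|//]]] k;
  [apply: Or31|apply: Or32|apply: Or33]; exact/val_inj.
Qed.

(** Inside a cell the minimum is attained by one term only, so no cancellation occurs and the
    valuation of lambda equals its tropical form. *)
Lemma trop_form_realized (F : fieldType) (c : 'I_3 -> puiseux F) d z e eps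
    (i : nat) (t : rat) :
    (2 : F) != 0 -> (3 : F) != 0 -> 0 < d -> adapted c d z e ->
    val_eq eps (d * (6 * z)%:R) -> (i < 6 * z)%N -> i%:R < t < i.+1%:R ->
  exists l1 l2 : puiseux F, [/\ nodal_cubic eps l1 l2,
    val_eq l1 (d * triangle1 (6 * z)%:R t),
    val_eq l2 (d * triangle2 (6 * z)%:R t) &
    val_eq (c 0 + c 1 * l1 + c 2 * l2) (d * trop_form (6 * e 0)%:~R
      (6 * e 1)%:~R (6 * e 2)%:~R (6 * z)%:R t)].
Proof.
move=> F2 F3 d0 ad heps iz /andP[it ti].
have tz : t < (6 * z)%:R by apply: lt_le_trans ti _; rewrite ler_nat.
have t0 : 0 < t by apply: le_lt_trans it; rewrite ler0n.
(* A parameter inside a cell is no integer, hence differs from the excluded values [2 * z], [3 * z]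
   and [4 * z]. *)
have nat_neq (n : nat) : t != n%:R.
  apply/negP => /eqP tn; move: it ti; rewrite tn !ltr_nat; lia.
have d3 (x y : rat) : x != y -> d * x != d * y.
  by rewrite (inj_eq (mulfI (lt0r_neq0 d0))).
have [|||||l1 [l2 [H h1 h2]]] := nodal_cubic_triangle F2 F3 (t := d * t) heps.
- by rewrite mulr_gt0.
- by rewrite ltr_pM2l.
- rewrite mulrCA; apply: d3; have := nat_neq (2 * z)%N.
  by apply: contra_neq; rewrite !natrM; lra.
- rewrite mulrCA; apply: d3; have := nat_neq (3 * z)%N.
  by apply: contra_neq; rewrite !natrM; lra.
- rewrite mulrCA [2 * _]mulrCA; apply: d3; have := nat_neq (4 * z)%N.
  by apply: contra_neq; rewrite !natrM; lra.
have T1 : triangle1 (d * (6 * z)%:R) (d * t) = d * triangle1 (6 * z)%:R t.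
  by rewrite /triangle1 minr_pMr ?ltW//; congr Num.min; ring.
have T2 : triangle2 (d * (6 * z)%:R) (d * t) = d * triangle2 (6 * z)%:R t.
  by rewrite /triangle2 minr_pMr ?ltW//; congr Num.min; ring.
rewrite T1 in h1; rewrite T2 in h2.
exists l1, l2; split=> //.
have [a1 [b1 [a2 [b2 [a [b [_ cell]]]]]]] := trop_form_cell z i (e 0) (e 1) (e 2).
have [|_ _ _] := cell rat t; first by rewrite !ltW.
rewrite it ti => /(_ isT); rewrite /trop_form.
have w1 : 0 <= triangle1 (6 * z)%:R t <= (6 * z)%:R.
  rewrite /triangle1 le_min ge_min; apply/andP.
  by split; [apply/andP; split|apply/orP; right]; lra.
have w2 : 0 <= triangle2 (6 * z)%:R t <= (6 * z)%:R.
  rewrite /triangle2 le_min ge_min; apply/andP.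
  by split; [apply/andP; split|apply/orP; left]; lra.
move: w1 w2 h1 h2; set w1 := triangle1 _ _; set w2 := triangle2 _ _.
move=> /andP[w10 w1z] /andP[w20 w2z] h1 h2.
have cge k : val_ge (c k) (d * (6 * e k)%:~R).
  have [->|ck] := eqVneq (c k) 0; first exact: val_ge0.
  by case: ((ad k).1 ck).
pose w (k : 'I_3) := [:: 0; w1; w2]`_k.
have wP k : 0 <= w k <= (6 * z)%:R.
  by case: k => -[|[|[|//]]] ?; rewrite /w/= ?w10 ?w20 ?w1z ?w2z ?lexx ?ler0n.
(* A term attaining the minimum has a nonzero coefficient: [w] varies by at most [6 * z], less than
   the margin built into [adapted]. *)
have lead k : (forall l, (6 * e k)%:~R + w k <= (6 * e l)%:~R + w l) ->
    val_eq (c k) (d * (6 * e k)%:~R).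
  move=> kmin; have [ck|ck] := eqVneq (c k) 0; last exact: (ad k).1.
  have [l] := (ad k).2 ck.
  rewrite -(ltr_int rat) rmorphD/= -pmulrn; move: (kmin l) (wP k) (wP l).
  rewrite !rmorphM/= natrM; lra.
have g0 := cge 0.
have g1 : val_ge (c 1 * l1) (d * ((6 * e 1)%:~R + w1)).
  by rewrite mulrDr; apply: val_geM h1.2.
have g2 : val_ge (c 2 * l2) (d * ((6 * e 2)%:~R + w2)).
  by rewrite mulrDr; apply: val_geM h2.2.
have ltd (x y : rat) : x < y -> d * x < d * y by rewrite ltr_pM2l.
case=> -[/[dup] /ltd m1 /ltW n1 /[dup] /ltd m2 /ltW n2].
- rewrite min_l ?le_min ?n1// -addrA; apply: val_eq_sum3 g1 g2 m1 m2.
  by apply: lead => k; case: (ord3E k) => ->; rewrite /w/= ?addr0 ?lexx.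
- rewrite min_r ?min_l ?ge_min ?n1// (addrC (c 0)) -addrA.
  apply: val_eq_sum3 g0 g2 m1 m2; rewrite mulrDr; apply: val_eqM h1.
  by apply: lead => k; case: (ord3E k) => ->; rewrite /w/= ?addr0 ?lexx.
- rewrite min_r ?min_r ?ge_min ?n1 ?orbT// addrC.
  apply: val_eq_sum3 g0 g1 m1 m2; rewrite mulrDr; apply: val_eqM h2.
  by apply: lead => k; case: (ord3E k) => ->; rewrite /w/= ?addr0 ?lexx.
Qed.

(** * Changes of projective coordinates and the Weierstrass form *)

Lemma mulmx3E (K : pzRingType) m (A : 'M[K]_(m, 3)) (L : 'cV[K]_3) i :
  (A *m L) i 0 = A i 0 * L 0 0 + A i 1 * L 1 0 + A i 2 * L 2 0.
Proof.
rewrite mxE !big_ord_recl big_ord0 addr0 addrA.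
rewrite (_ : lift ord0 ord0 = 1); last exact/val_inj.
by rewrite (_ : lift ord0 (lift ord0 ord0) = 2)//; exact/val_inj.
Qed.

Section Homogenization.
Variable K : fieldType.
Implicit Types (g : mpoly 2 K) (P Q : 'cV[K]_3) (M : 'M[K]_3).

Definition affine_point (x : 'rV[K]_2) : 'cV[K]_3 :=
  \col_k [:: 1; x ord0 ord0; x ord0 ord_max]`_k.

(** The exponent [d - mdeg m] in [homogenize] is a truncated subtraction: it is exact under the
    degree bound, and harmless when the homogenizing coordinate is 1. *)
Lemma meval_homogenize n g P : P 0 0 != 0 -> (msize g <= n.+1)%N \/ P 0 0 = 1 ->
  meval (fun k => P k 0) (homogenize n g) =
  P 0 0 ^+ n * meval ((\row_k (P (lift ord0 k) 0 / P 0 0)) ord0) g.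
Proof.
move=> P0 gP; rewrite /homogenize raddf_sum/= mevalE big_distrr/=.
rewrite !big_seq; apply: eq_bigr => m mg.
rewrite mevalZ mevalM rmorphXn/= mevalXU [RHS]mulrCA; congr (_ * _).
rewrite !big_ord_recl !big_ord0 !mulr1 mevalM !rmorphXn/= !mevalXU !mxE.
rewrite !exprMn mulrACA -exprD.
have -> : (m ord0 + m (lift ord0 ord0) = mdeg m)%N.
  by rewrite mdegE !big_ord_recl big_ord0 addn0.
rewrite [RHS]mulrCA [LHS]mulrC; congr (_ * _).
case: gP => [gn|->]; last by rewrite invr1 !expr1n mulr1.
have mn : (mdeg m <= n)%N by rewrite -ltnS (leq_trans (msize_mdeg_lt mg)).
by rewrite -{2}(subnK mn) exprD exprVn mulfK// expf_neq0.
Qed.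

Lemma linear_change_point g M Q (u a b x y : K) :
    msize g = 4 ->
    comp_mpoly [tuple \sum_(k < 3) M i k *: Xvar K k | i < 3] (homogenize 3 g)
      = u *: homogenize 3 (weierstrass a b) ->
    y ^+ 2 = x ^+ 3 + a * x + b ->
  Q = M *m \col_k [:: 1; x; y]`_k -> Q 0 0 != 0 ->
  meval ((\row_k (Q (lift ord0 k) 0 / Q 0 0)) ord0) g = 0.
Proof.
pose P : 'cV[K]_3 := \col_k [:: 1; x; y]`_k.
move=> g4 /(congr1 (meval (fun k => P k 0))) + xy QE Q0.
rewrite comp_mpoly_meval mevalZ meval_homogenize; last 2 first.
- by rewrite mxE/= oner_neq0.
- by right; rewrite mxE.
have -> : meval ((\row_k (P (lift ord0 k) 0 / P 0 0)) ord0) (weierstrass a b) = 0.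
  rewrite /weierstrass/= mevalB !mevalD mevalC mevalZ !rmorphXn/= !mevalXU !mxE/=.
  by rewrite !divr1 xy subrr.
rewrite mulr0 mulr0 (meval_eq (v2 := fun k => Q k 0)); last first.
  move=> i; rewrite tnth_mktuple raddf_sum QE mxE; apply: eq_bigr => k _.
  by rewrite /= mevalZ mevalXU.
rewrite meval_homogenize ?g4//; last by left.
by move/eqP; rewrite mulf_eq0 expf_eq0/= (negbTE Q0) => /eqP.
Qed.

Definition affine_form (N : 'M[K]_3) (k : 'I_3) : mpoly 2 K :=
  mpolyC 2 (N k 0) + N k 1 *: Xvar K ord0 + N k 2 *: Xvar K ord_max.

Lemma meval_affine_form N k (x : 'rV[K]_2) :
  meval (x ord0) (affine_form N k) = (N *m affine_point x) k 0.
Proof.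
by rewrite /affine_form !mevalD mevalC !mevalZ !mevalXU mulmx3E !mxE/= mulr1.
Qed.

Lemma affine_point_inj : injective affine_point.
Proof.
move=> x y /colP H; apply/rowP => k.
case: k => -[|[|//]] k2.
- by have := H 1; rewrite !mxE/= (_ : Ordinal k2 = ord0)//; exact/val_inj.
- by have := H 2; rewrite !mxE/= (_ : Ordinal k2 = ord_max)//; exact/val_inj.
Qed.

Lemma affine_pointE Q : Q 0 0 != 0 ->
  affine_point (\row_k (Q (lift ord0 k) 0 / Q 0 0)) = (Q 0 0)^-1 *: Q.
Proof.
move=> Q0; apply/colP => k; rewrite !mxE.
case: (ord3E k) => ->/=; rewrite ?mxE mulrC ?mulfV//.
- by rewrite (_ : lift _ _ = 1)//; exact/val_inj.
- by rewrite (_ : lift _ _ = 2)//; exact/val_inj.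
Qed.

End Homogenization.

(** Here [eps] is the discriminant [4 * a ^+ 3 + 27 * b ^+ 2] divided by [27 * b ^+ 2]. Its inverse
    is 1 - j / 1728, of valuation [q] because [q < 0]. *)
Lemma weierstrass_nodal (F : numClosedFieldType) (a b : puiseux F) (q : rat) :
    4 * a ^+ 3 + 27 * b ^+ 2 != 0 ->
    val_eq (1728 * (4 * a ^+ 3) / (4 * a ^+ 3 + 27 * b ^+ 2)) q -> q < 0 ->
  exists (T : 'M[puiseux F]_3) eps,
    [/\ T \in unitmx, val_eq eps (- q) & forall l1 l2, nodal_cubic eps l1 l2 ->
      exists x y, T *m (\col_k [:: 1; l1; l2]`_k) = \col_k [:: 1; x; y]`_k /\
        y ^+ 2 = x ^+ 3 + a * x + b].
Proof.
move=> D0 jq q0.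
have nat0 n : n.+1%:R != 0 :> puiseux F.
  by apply: puiseux_nat_neq0; rewrite pnatr_eq0.
have [[K2 K3] K27] := (nat0 1%N, nat0 2%N, nat0 26%N).
pose jv := 1728 * (4 * a ^+ 3) / (4 * a ^+ 3 + 27 * b ^+ 2).
have invq : val_eq (27 * b ^+ 2 / (4 * a ^+ 3 + 27 * b ^+ 2)) q.
  have h1728 : val_eq (1728%:R : puiseux F) 0.
    by apply: val_eq_nat; rewrite pnatr_eq0.
  have -> : 27 * b ^+ 2 / (4 * a ^+ 3 + 27 * b ^+ 2) = - (jv / 1728%:R) + 1.
    by rewrite /jv; field; rewrite D0 (nat0 1727%N).
  apply: (val_eqDl q0); last exact: (val_ge_nat F 1).
  by apply: val_eqN; rewrite -[q]subr0; apply: val_eq_div.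
have epsq := val_eqV invq; rewrite invf_div in epsq.
have b0 : b != 0.
  by apply: contraTneq (val_eq_neq0 invq) => ->; rewrite expr0n/= mulr0 mul0r eqxx.
have a0 : a != 0.
  by apply: contraTneq (val_eq_neq0 jq) => ->; rewrite expr0n/= !mulr0 mul0r eqxx.
(* [r] is the double root that the cubic would have for zero discriminant. With x = r (1 + z), the
   cubic becomes [r ^+ 3] times z^3 + 3 z^2 + 3 eps z + eps; the choice of [s] lets y = s (l1 + l2)
   / 2 absorb 3 z^2, as ((l1 + l2) / 2)^2 - z^2 = l1 l2. *)
pose r := - 3 * b / (2 * a).
have r0 : r != 0.
  by rewrite /r !mulf_neq0 ?invr_eq0 ?oppr_eq0 ?mulf_neq0.
have [s sE] := puiseux_sqrt (3 * r ^+ 3).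
have s0 : s != 0.
  apply: contra_neq (mulf_neq0 K3 (expf_neq0 3 r0)) => s0.
  by rewrite -sE s0 expr0n.
pose T : 'M[puiseux F]_3 := \matrix_(i, k)
  (nth [::] [:: [:: 1; 0; 0]; [:: r; - r / 2; r / 2]; [:: 0; s / 2; s / 2]] i)`_k.
pose S : 'M[puiseux F]_3 := \matrix_(i, k)
  (nth [::] [:: [:: 1; 0; 0]; [:: 1; - r^-1; s^-1]; [:: -1; r^-1; s^-1]] i)`_k.
have TS : T *m S = 1%:M.
  apply/matrixP => i k; case: (ord3E i) => ->; case: (ord3E k) => ->;
    rewrite !mxE !big_ord_recl big_ord0 !mxE/=; field; rewrite ?r0 ?s0 ?K2//.
pose eps := (4 * a ^+ 3 + 27 * b ^+ 2) / (27 * b ^+ 2).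
exists T, eps; split=> //.
  by case: (mulmx1_unit TS).
move=> l1 l2; rewrite /nodal_cubic; set z := (l2 - l1) / 2 => l12.
exists (r * (1 + z)), (s * ((l1 + l2) / 2)); split.
  apply/colP => k; case: (ord3E k) => ->;
    rewrite !mxE !big_ord_recl big_ord0 !mxE/= /z; field; rewrite ?K2//.
rewrite exprMn sE.
have -> : ((l1 + l2) / 2) ^+ 2 = z ^+ 2 + l1 * l2 by rewrite /z; field.
by rewrite l12 /r /eps; field; rewrite a0 b0 K2 K3 K27.
Qed.

(** * Affine coordinates as recursive linear modifications *)

Section LinearRepairs.
Variable R : realType.
Local Notation K := (puiseuxC R).

Lemma oppe_pval_neq_pinfty (f : K) : (- pval R f)%E != +oo%E.
Proof.
have [->|/(pvalP R)[q [_ _ ->]]] := eqVneq f 0; first by rewrite pval0.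
by [].
Qed.

Definition form_trop_linear (a b c : K) : trop_linear R :=
  TropLinear (And3 (oppe_pval_neq_pinfty a) (oppe_pval_neq_pinfty b)
    (oppe_pval_neq_pinfty c)).

Definition affine_coords (N : 'M[K]_3) : seq (mpoly 2 K) :=
  [:: affine_form N 0; affine_form N 1; affine_form N 2].

(** Each form lifts its own tropicalization in the two plane coordinates. These are kept until all
    three forms are adjoined, then dropped. *)
Lemma linear_repair_affine (N : 'M[K]_3) : linear_repair (affine_coords N).
Proof.
have step s k : linear_repair (plane_coords R ++ s) ->
    linear_repair (plane_coords R ++ rcons s (affine_form N k)).
  move=> Hs; rewrite -rcons_cat.
  exact: (@repair_modify _ _ 0 1 (form_trop_linear (N k 0) (N k 1) (N k 2))) Hs _ _ _ _.
apply: (@repair_drop _ (plane_coords R ++ affine_coords N)).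
  have start : linear_repair (plane_coords R ++ [::]) by exact: repair_start.
  exact: (step _ 2 (step _ 1 (step _ 0 start))).
exact: suffix_subseq.
Qed.

Lemma embeds_plane_affine (N : 'M[K]_3) : N \in unitmx ->
  embeds_plane (affine_coords N).
Proof.
move=> Nu x y; rewrite /= !meval_affine_form => -[E0 E1 E2].
apply/affine_point_inj/(can_inj (mulKmx Nu))/colP => k.
by case: (ord3E k) => ->.
Qed.

End LinearRepairs.

(** * The re-embedding of the given cubic and the points over its cycle *)

Unset Implicit Arguments.
Set Strict Implicit.

Theorem theorem4p1 (R : realType) (g : mpoly 2 (puiseuxC R)) (j : (puiseuxC R)) :
  plane_elliptic_cubic g ->
  is_j_invariant g j ->
  (pval R j < 0)%E ->
  (exists L : R, contains_cycle (trop_curve g (plane_coords R)) L /\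
                 L%:E <> (- pval R j)%E) ->
  exists s : seq (mpoly 2 (puiseuxC R)),
    [/\ linear_repair s, (size s <= 4)%N, embeds_plane s &
        exists L : R, contains_cycle (trop_curve g s) L /\
                      L%:E = (- pval R j)%E].
Proof.
move=> [g4 _] [M [u [a [b [Mu u0 D0 gE jE]]]]] j0 _.
have [q jq] : exists q, val_eq j q.
  apply: val_eq_ex; apply/eqP => jz; move: j0; rewrite jz pval0.
  by rewrite ltNge leey.
have pj : pval R j = (ratr q : R)%:E by exact: pval_val_eq.
have q0 : q < 0 by move: j0; rewrite pj lte_fin ltrq0.
rewrite jE in jq.
have [T [eps [Tu epsq TP]]] := weierstrass_nodal D0 jq q0.
have MTu : M *m T \in unitmx by rewrite unitmx_mul Mu.
have [A AE Au] : exists2 A, A = M *m T & A \in unitmx by exists (M *m T).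
(* [A] takes (1, l1, l2) to homogeneous coordinates of the given plane, and its row 0 holds the
   coefficients of lambda. Hence the forms of [N] restrict to 1 / lambda, l1 / lambda and l2 /
   lambda. *)
pose N := invmx A.
have [||d [z [e [d0 z0 qE ad]]]] := @adapted_ex _ (fun k => A 0 k) (- q).
- by rewrite oppr_gt0.
(* A zero row would make the corner entry of [A] times its inverse vanish. *)
- apply: contrapT => /forallNP A0; have /eqP := oner_neq0 (puiseuxC R); apply.
  have := congr1 (fun B : 'M_3 => B 0 0) (mulmxV Au); rewrite !mxE eqxx => E.
  rewrite -[LHS]/(true%:R) -E.
  by apply: big1 => k _; have /negP/negPn/eqP -> := A0 k; rewrite mul0r.
exists (affine_coords N); split=> //.
- exact: linear_repair_affine.
- by apply: embeds_plane_affine; rewrite unitmx_inv.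
exists (ratr (d * (6 * z)%:R)); split; last by rewrite pj -qE rmorphN.
apply: (@trop_point_cycle R z d (e 0) (e 1) (e 2)) => // i t iz it.
have K2 : (2 : complex R) != 0 by rewrite pnatr_eq0.
have K3 : (3 : complex R) != 0 by rewrite pnatr_eq0.
rewrite qE in epsq.
have [l1 [l2 [H h1 h2 hm]]] := trop_form_realized K2 K3 d0 ad epsq iz it.
have [x [y [TE xy]]] := TP _ _ H.
pose L : 'cV[puiseuxC R]_3 := \col_k [:: 1; l1; l2]`_k.
pose Q := A *m L.
have QE : Q = M *m \col_k [:: 1; x; y]`_k by rewrite /Q AE -mulmxA TE.
have Q0 : Q 0 0 = A 0 0 + A 0 1 * l1 + A 0 2 * l2.
  by rewrite /Q mulmx3E !mxE/= mulr1.
rewrite -Q0 in hm; have Qn0 := val_eq_neq0 hm.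
(* Lambda has a finite valuation at this point, so [Q 0 0] is nonzero and the point lies in the
   affine plane. *)
pose X : 'rV_2 := \row_k (Q (lift ord0 k) 0 / Q 0 0).
have XE : affine_point X = (Q 0 0)^-1 *: Q by exact: affine_pointE.
have sE k : meval (X ord0) (affine_form N k) = L k 0 / Q 0 0.
  by rewrite meval_affine_form XE -scalemxAr /N /Q mulKmx// mxE mulrC.
have L0 : val_eq (L 0 0) 0.
  by rewrite mxE; apply: (val_eq_nat (n := 1)); exact: oner_neq0.
have LQ k r : val_eq (L k 0) r ->
    val_eq (meval (X ord0) (affine_form N k)) (r - d * trop_form (6 * e 0)%:~R
      (6 * e 1)%:~R (6 * e 2)%:~R (6 * z)%:R t).
  by move=> Lr; rewrite sE; exact: val_eq_div.
have gX : meval (X ord0) g = 0 by exact: linear_change_point g4 gE xy QE Qn0.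
have Lv (k : 'I_3) : val_eq (L k 0)
    (d * [:: 0; triangle1 (6 * z)%:R t; triangle2 (6 * z)%:R t]`_k).
  by have [->|->|->] := ord3E k; rewrite /= ?mulr0//; rewrite mxE.
have sv (k : 'I_3) : val_eq (meval (X ord0) (affine_coords N)`_k)
    (- (d * trop_point z (e 0) (e 1) (e 2) t 0 k)).
  have -> : (affine_coords N)`_k = affine_form N k by case: (ord3E k) => ->.
  apply: eq_ind (LQ k _ (Lv k)) _ _.
  by rewrite mxE; have [->|->|->] := ord3E k => /=; ring.
exists X.
  split=> [|k]; first exact: gX.
  exact: val_eq_neq0 (sv k).
apply/rowP => k; rewrite mxE (pval_val_eq _ (sv k)) [RHS]mxE [in RHS]mxE.
by rewrite /= (rmorphN (@ratr R)) opprK (rmorphM (@ratr R)).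
Qed.
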